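(* Let $p$ be an odd prime, $n\ge1$, and let $F$ be a field with $\operatorname{char}(F)\ne p$ and $\mu_p\not\subseteq F$. Suppose $p\nmid[F(\mu_{p^n}):F]$. Let $M=F(\mu_{p^n})$, let $m\in M^*-M^{*p}$, and let $T=M(\sqrt[p^n]{m})$. Let $J=F(p)(\mu_p)$. Then the following are equivalent: (1) $T=S\cdot M$ for some cyclic (Galois) field extension $S$ of $F$ of degree $p^n$; (2) $T\subseteq J$; (3) $g\cdot[m]=[m^{\alpha(g)}]$ in $M^*/M^{*p^n}$ for each $g\in\mathrm{Gal}(M/F)$, where $\alpha:\mathrm{Gal}(M/F)\to(\mathbb Z/p^n\mathbb Z)^*$ is the cyclotomic character.
   Context: All fields lie in a fixed algebraic closure of $F$; $\mu_k$ denotes the group of $k$-th roots of unity in it. $F(p)$ denotes the maximal $p$-extension of $F$, i.e. the compositum of all finite Galois extensions of $F$ of degree a power of $p$. $[m]$ denotes the class of $m$ in $M^*/M^{*p^n}$, on which $\mathrm{Gal}(M/F)$ acts naturally. The cyclotomic character is defined by $g(\omega)=\omega^{\alpha(g)}$ for all $g\in\mathrm{Gal}(M/F)$, $\omega\in\mu_{p^n}$. *)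

(* Defs.v *)
From HB Require Import structures.
From mathcomp Require Import all_boot all_order all_algebra all_fingroup
  all_solvable all_field.
From mathcomp Require Import boolp classical_sets.
Set Implicit Arguments.
Unset Strict Implicit.
Unset Printing Implicit Defensive.
Import GRing.Theory.
Local Open Scope classical_set_scope.
Local Open Scope ring_scope.

Definition mu (R : nzRingType) (k : nat) : set R := [set w | k.-unity_root w].

Definition is_subfield (C : fieldType) (K : set C) : Prop :=
  divring_closed [in K].

Definition generated_field (C : fieldType) (A : set C) : set C :=
  smallest (@is_subfield C) A.

Definition adjoin (C : fieldType) (K A : set C) : set C :=
  generated_field (K `|` A).

Definition compositum (C : fieldType) (K L : set C) : set C :=
  generated_field (K `|` L).

Definition algebraic_closure (F : fieldType) (C : closedFieldType)
    (iota : {rmorphism F -> C}) : Prop :=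
  forall x : C, algebraicOver iota x.

(* Finite extensions of F inside the algebraic closure C are presented by an
   abstract extension L of F (so that \dim, 'Gal and galois apply to it) and
   an embedding of L in C over F; the subfield of C is the range of j. *)
Definition over_base (F : fieldType) (C : closedFieldType)
    (iota : {rmorphism F -> C}) (L : fieldExtType F)
    (j : {rmorphism L -> C}) : Prop :=
  forall a : F, j a%:A = iota a.

Definition galois_ext (F : fieldType) (C : closedFieldType)
    (iota : {rmorphism F -> C}) (d : nat) (E : set C) : Prop :=
  exists (L : splittingFieldType F) (j : {rmorphism L -> C}),
    [/\ over_base iota j, range j = E, galois 1 {:L} & \dim {:L} = d].

Definition cyclic_ext (F : fieldType) (C : closedFieldType)
    (iota : {rmorphism F -> C}) (d : nat) (E : set C) : Prop :=
  exists (L : splittingFieldType F) (j : {rmorphism L -> C}),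
    [/\ over_base iota j, range j = E, galois 1 {:L},
        cyclic 'Gal({:L} / 1%VS)%g & \dim {:L} = d].

Definition max_p_ext (F : fieldType) (C : closedFieldType)
    (iota : {rmorphism F -> C}) (p : nat) : set C :=
  generated_field
    (\bigcup_(E in [set E | exists k, galois_ext iota (p ^ k) E]) E).

(* The coset of x modulo the subgroup of k-th powers of the unit group. *)
Definition power_class (K : fieldType) (k : nat) (x : K) : set K :=
  [set x * z ^+ k | z in [set z | z != 0]].

(* When M contains a primitive N-th root of unity and 1 < N (for N <= 1 the
   type 'Z_N is the ring of integers mod 2), this determines alpha. *)
Definition cyclotomic_character (F : fieldType) (M : splittingFieldType F)
    (N : nat) (alpha : gal_of {:M} -> {unit 'Z_N}) : Prop :=
  forall g, g \in 'Gal({:M} / 1%VS)%g ->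
  forall w : M, mu N w -> g w = w ^+ (FinRing.uval (alpha g)).

(* Main.v *)
(* Put N = p^n, G = Gal(M/F), and let w be a primitive N-th root of unity.  As
   Gal(M/F(mu_p)) is a p-group of order prime to p, M = F(mu_p), which gives
   (1) => (2).  For (2) => (3), lift g in G to a finite Galois extension E of F
   containing t and raise the lift to a power e = 1 mod #[g] divisible by the
   degrees of the p-extensions needed to express t: the resulting h restricts
   to g on M, is trivial on these p-extensions, and so commutes on t with every
   tau in Gal(E/M).  Since tau multiplies t by a root of unity zeta and
   h(zeta) = zeta^alpha(g), the element h(t)/t^alpha(g) is fixed by Gal(E/M);
   its N-th power is g(m)/m^alpha(g).  For (3) => (1), the same computation read
   backwards shows that T/F is Galois and that A = Gal(T/M), cyclic of order N
   by Kummer theory, is central in Gal(T/F); its index is prime to p, so by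
   Schur-Zassenhaus A has a complement B, normal because A is central, and S is
   the fixed field of B. *)

Require Import Defs.
From HB Require Import structures.
From mathcomp Require Import all_boot all_order all_algebra all_fingroup
  all_solvable all_field.
From mathcomp Require Import boolp classical_sets.
Set Implicit Arguments.
Unset Strict Implicit.
Unset Printing Implicit Defensive.
Import GRing.Theory.
Local Open Scope classical_set_scope.
Local Open Scope ring_scope.

(** * Finite and Galois extensions realised inside [C] *)

(** A nonzero polynomial of least size vanishing at [z] is irreducible, so the quotient of F[X] by
    it is the required field. *)
Lemma simple_extension (F : fieldType) (C : fieldType)
    (iota : {rmorphism F -> C}) (z : C) :
  algebraicOver iota z ->
  exists (L : fieldExtType F) (j : {rmorphism L -> C}) (y : L),
    [/\ forall a : F, j a%:A = iota a, j y = z & <<1; y>>%VS = fullv].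
Proof.
case=> q0 nz_q0 q0z.
pose P k := `[< exists q : {poly F},
  [/\ q != 0, root (map_poly iota q) z & size q = k] >].
have exP : exists k, P k by exists (size q0); apply/asboolP; exists q0.
case: (ex_minnP exP) => k /asboolP[q [nz_q qz sz_q]] min_k.
have irr_q : irreducible_poly q.
  apply/(subfx_irreducibleP qz nz_q) => r rz nz_r.
  by rewrite sz_q; apply: min_k; apply/asboolP; exists r.
exists (SubFieldExtType qz irr_q), (@subfx_inj _ _ iota z q), (subfx_root iota z q).
split; [exact: subfx_inj_base | exact: subfx_inj_root |].
apply/vspaceP=> x; rewrite memvf; apply/Fadjoin_polyP.
have [r ->] := subfxEroot qz nz_q x.
exists (map_poly (in_alg (SubFieldExtType qz irr_q)) r) => //.
by apply/polyOverP=> i; rewrite coef_map memvZ ?mem1v.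
Qed.

(** The elements of [s] are adjoined one at a time. Each step gives an extension [L1] of the
    previous field [L0], which is then viewed over [F]. *)
Lemma finite_subextension (F : fieldType) (C : closedFieldType)
    (iota : {rmorphism F -> C}) (s : seq C) :
  (forall x, x \in s -> algebraicOver iota x) ->
  exists (L : fieldExtType F) (j : {rmorphism L -> C}) (s1 : seq L),
    [/\ over_base iota j, map j s1 = s & <<1 & s1>>%VS = fullv].
Proof.
elim/last_ind: s => [|s z IHs] alg_s.
  exists F^o, iota, [::]; split=> //.
    by move=> a; congr (iota _); rewrite /GRing.scale /= mulr1.
  rewrite Fadjoin_nil; apply/vspaceP=> x; rewrite memvf.
  by apply/vlineP; exists x; rewrite /GRing.scale /= mulr1.
have [|L0 [j0 [s0 [j0F Ds0 gen0]]]] := IHs.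
  by move=> x sx; apply: alg_s; rewrite mem_rcons inE sx orbT.
have algz : algebraicOver j0 z.
  have [|q nz_q qz] := alg_s z; first by rewrite mem_rcons inE eqxx.
  exists (map_poly (in_alg L0) q); first by rewrite map_poly_eq0.
  by rewrite -map_poly_comp (eq_map_poly (f := _ \o _) (g := iota)).
have [L1 [j1 [y [j1L0 j1y gen1]]]] := simple_extension algz.
pose L : fieldExtType F := baseFieldType L1.
pose j : {rmorphism L -> C} := j1.
pose inL : L0 -> L := in_alg L1.
exists L, j, (rcons (map inL s0) y); split.
- by move=> a; rewrite -j0F -j1L0.
- rewrite map_rcons -map_comp -Ds0; congr rcons; last by [].
  by apply: eq_map => x /=; rewrite -j1L0.
have inLE x : inL x \in <<1 & map inL s0>>%VS.
  have : x \in <<1 & s0>>%VS by rewrite gen0 memvf.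
  elim/last_ind: (s0) x => [|s1 u IHs1] x.
    by rewrite !Fadjoin_nil => /vlineP[a ->]; apply/vlineP; exists a.
  rewrite map_rcons !adjoin_rcons => /Fadjoin_polyP[q /polyOverP Kq ->].
  rewrite /inL -horner_map; apply: mempx_Fadjoin.
  by apply/polyOverP=> i; rewrite coef_map; apply: IHs1.
apply/vspaceP=> x; rewrite memvf adjoin_rcons; apply/Fadjoin_polyP.
have /Fadjoin_polyP[q /polyOverP q1 ->] : (x : L1) \in <<1; y>>%VS.
  by rewrite gen1 memvf.
exists q => //; apply/polyOverP=> i; have /vlineP[a ->] := q1 i.
exact: inLE.
Qed.

(** Any separable polynomial over [F] may serve, so no finite extension containing [x] has to be
    chosen first. *)
Definition separable_over (F C : fieldType) (iota : {rmorphism F -> C}) (x : C) :=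
  exists2 q : {poly F}, separable_poly q & root (map_poly iota q) x.

Lemma separable_over_algebraic (F C : fieldType) (iota : {rmorphism F -> C}) x :
  separable_over iota x -> algebraicOver iota x.
Proof. by case=> q sep_q qx; exists q => //; apply: separable_poly_neq0. Qed.

Lemma map_poly_over_base (F : fieldType) (C : closedFieldType)
    (iota : {rmorphism F -> C}) (L : fieldExtType F) (j : {rmorphism L -> C})
    (q : {poly F}) :
  over_base iota j -> map_poly j (map_poly (in_alg L) q) = map_poly iota q.
Proof. by move=> jF; rewrite -map_poly_comp; apply: eq_map_poly. Qed.

Lemma separable_overE (F : fieldType) (C : closedFieldType)
    (iota : {rmorphism F -> C}) (L : fieldExtType F) (j : {rmorphism L -> C})
    (x : L) :
  over_base iota j -> separable_over iota (j x) <-> separable_element 1 x.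
Proof.
move=> jF; split=> [[q sep_q] | sep_x].
  rewrite -(map_poly_over_base _ jF) fmorph_root => qx.
  apply/separable_elementP; exists (map_poly (in_alg L) q).
  by split; rewrite ?separable_map //; apply/polyOver1P; exists q.
have /polyOver1P[q Dq] := minPolyOver 1 x; exists q.
  by rewrite -(separable_map (in_alg L)) -Dq.
by rewrite -(map_poly_over_base _ jF) fmorph_root -Dq root_minPoly.
Qed.

(** Multiply separable polynomials vanishing at the elements of [s]. The product [Q] may have
    repeated roots, but each root is separable, so its splitting field is generated by separable
    elements and is Galois. *)
Lemma galois_hull (F : fieldType) (C : closedFieldType)
    (iota : {rmorphism F -> C}) (s : seq C) :
  (forall x, x \in s -> separable_over iota x) ->
  exists (E : splittingFieldType F) (j : {rmorphism E -> C}),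
    [/\ over_base iota j, galois 1 {:E} & forall x, x \in s -> range j x].
Proof.
move=> sep_s; have {sep_s}[Q [nzQ sepQ Qs]] : exists Q : {poly F}, [/\ Q != 0,
    forall x, root (map_poly iota Q) x -> separable_over iota x
  & forall x, x \in s -> root (map_poly iota Q) x].
  elim: s sep_s => [|z s IHs] sep_s.
    by exists 1; split; rewrite ?oner_eq0 // => x; rewrite rmorph1 rootE hornerC oner_eq0.
  have [|Q [nzQ sepQ Qs]] := IHs.
    by move=> x sx; apply: sep_s; rewrite inE sx orbT.
  have [|q sep_q qz] := sep_s z; first exact: mem_head.
  exists (q * Q); split=> [|x|x].
  - by rewrite mulf_neq0 // separable_poly_neq0.
  - by rewrite rmorphM rootM => /orP[qx | /sepQ//]; exists q.
  - by rewrite rmorphM rootM inE => /orP[/eqP-> | /Qs->]; rewrite ?qz ?orbT.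
have [rs DQ] := closed_field_poly_normal (map_poly iota Q).
have rsE x : (x \in rs) = root (map_poly iota Q) x.
  by rewrite DQ rootZ ?lead_coef_eq0 ?map_poly_eq0 // root_prod_XsubC.
have [|L [j [s1 [jF Ds1 gen1]]]] := @finite_subextension F C iota rs.
  by move=> x; rewrite rsE => /sepQ/separable_over_algebraic.
have splitL : splitting_field_axiom L.
  exists (map_poly (in_alg L) Q); first by apply/polyOver1P; exists Q.
  exists s1 => //; rewrite -(eqp_map j) (map_poly_over_base _ jF) DQ.
  rewrite lead_coef_map rmorph_prod -Ds1 big_map.
  under [X in _ %= X]eq_bigr do rewrite rmorphB /= map_polyX map_polyC.
  by rewrite eqp_scale // fmorph_eq0 lead_coef_eq0.
pose E : splittingFieldType F :=
  HB.pack L (FieldExt_isSplittingField.Build F L splitL).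
exists E, j; split=> // [|x sx].
  apply/and3P; split; [exact: subvf | | exact: normalFieldf].
  rewrite -[X in separable _ X]gen1; apply: separable_Fadjoin_seq.
  apply/allP=> z s1z; apply/(separable_overE _ jF)/sepQ.
  by rewrite -rsE -Ds1 map_f.
have: x \in map j s1 by rewrite Ds1 rsE Qs.
by case/mapP=> y _ ->; exists y.
Qed.

Lemma over_baseZ (F : fieldType) (C : closedFieldType)
    (iota : {rmorphism F -> C}) (L : fieldExtType F) (j : {rmorphism L -> C}) :
  over_base iota j -> forall a x, j (a *: x) = iota a * j x.
Proof. by move=> jF a x; rewrite -mulr_algl rmorphM /= jF. Qed.

Lemma embedding_over_base (F : fieldType) (C : closedFieldType)
    (iota : {rmorphism F -> C}) (L E : fieldExtType F)
    (jL : {rmorphism L -> C}) (jE : {rmorphism E -> C}) :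
  over_base iota jL -> over_base iota jE -> range jL `<=` range jE ->
  exists f : 'AHom(L, E), forall x, jE (f x) = jL x.
Proof.
move=> jLF jEF sLE.
have /choice[g Dg] : forall x : L, exists y : E, jE y = jL x.
  by move=> x; have [|y _ <-] := sLE (jL x); [exists x | exists y].
have g_lin : linear g.
  move=> a x y; apply: (fmorph_inj jE).
  by rewrite Dg !rmorphD /= !(over_baseZ jLF, over_baseZ jEF) !Dg.
pose gL : {linear L -> E} := HB.pack g (GRing.isLinear.Build _ _ _ _ g g_lin).
have g_ahom : ahom_in {:L} (linfun gL).
  apply/ahom_inP; split=> [x y _ _|]; rewrite !lfunE /=.
    by apply: (fmorph_inj jE); rewrite Dg !rmorphM /= !Dg.
  by apply: (fmorph_inj jE); rewrite Dg !rmorph1.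
by exists (AHom g_ahom) => x; rewrite lfunE /= Dg.
Qed.

(** By normality the minimal polynomial of [x] over [F] splits in [L]. Its roots in [E] thus lie in
    the image of [f], which [h] therefore preserves. *)
Lemma restrict_automorphism (F : fieldType) (L : splittingFieldType F)
    (E : fieldExtType F) (f : 'AHom(L, E)) (h : 'AEnd(E)) :
  exists2 s : gal_of {:L}, s \in 'Gal({:L} / 1%VS)%g &
    forall x, f (s x) = h (f x).
Proof.
have hf_img x : h (f x) \in limg f.
  have [r /eqP Dr] := splitting_field_normal 1 x.
  have /polyOver1P[q Dq] := minPolyOver 1 x.
  have alg_map (K1 K2 : fieldExtType F) (u : 'AHom(K1, K2)) :
      map_poly u (map_poly (in_alg K1) q) = map_poly (in_alg K2) q.
    by rewrite -map_poly_comp; apply: eq_map_poly => a /=; rewrite linearZ rmorph1.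
  have: root (map_poly h (map_poly f (minPoly 1 x))) (h (f x)).
    by rewrite !fmorph_root root_minPoly.
  rewrite Dq !alg_map -(alg_map _ _ f) -Dq Dr rmorph_prod.
  under eq_bigr do rewrite rmorphB /= map_polyX map_polyC.
  rewrite -(big_map f xpredT (fun z => 'X - z%:P)) root_prod_XsubC.
  by case/mapP=> y _ ->; rewrite memv_img ?memvf.
pose g := (f^-1 \o (h \o f))%VF.
have Dg x : f (g x) = h (f x).
  by rewrite !comp_lfunE limg_lfunVK.
have g_ahom : ahom_in {:L} g.
  apply/ahom_inP; split=> [x y _ _|]; apply: (fmorph_inj f).
    by rewrite /= Dg !rmorphM /= !Dg.
  by rewrite /= Dg !rmorph1.
have [|s sG Ds] := @kAut_to_gal _ L 1%AS {:L}%AS (AHom g_ahom).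
  by rewrite kAutfE; apply: k1AHom.
by exists s => // x; rewrite -Ds ?memvf // Dg.
Qed.

(** The conjugate of [s] by [f] is an embedding of the image of [f] into [E]; it extends to [E]
    because [E] is normal over [F]. *)
Lemma lift_automorphism (F : fieldType) (L E : splittingFieldType F)
    (f : 'AHom(L, E)) (s : gal_of {:L}) :
  exists2 h : gal_of {:E}, h \in 'Gal({:E} / 1%VS)%g &
    forall x, h (f x) = f (s x).
Proof.
have fK : cancel f (f^-1)%VF.
  by apply: lker0_lfunK; apply: AHom_lker0.
pose g := (f \o (s \o f^-1))%VF.
have Dg x : g (f x) = f (s x) by rewrite !comp_lfunE /= fK.
have g_hom : kHom 1 (limg f) g.
  apply/kHomP_tmp; split=> [_ /vlineP[a ->] | _ _ /memv_imgP[x _ ->] /memv_imgP[y _ ->]].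
    by rewrite -(rmorph1 f) -linearZ Dg !linearZ /= !rmorph1.
  by rewrite -rmorphM !Dg /= !rmorphM.
have [|||h hG Dh] := @kHom_to_gal _ E 1%AS [aspace of limg f] {:E}%AS g.
- by rewrite sub1v subvf.
- exact: normalFieldf.
- exact: g_hom.
by exists h => // x; rewrite -Dh ?Dg // memv_img ?memvf.
Qed.

(** * Subfields of [C] generated by sets *)

Lemma is_subfieldP (C : fieldType) (K : set C) :
  is_subfield K <-> [/\ K 1, forall x y, K x -> K y -> K (x - y)
                      & forall x y, K x -> K y -> K (x / y)].
Proof.
split=> [[K1 KB KV] | [K1 KB KV]]; split=> //.
- by rewrite inE in K1.
- by move=> x y Kx Ky; have := KB x y; rewrite !inE; apply.
- by move=> x y Kx Ky; have := KV x y; rewrite !inE; apply.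
- by rewrite inE.
- by move=> x y; rewrite !inE; apply: KB.
- by move=> x y; rewrite !inE; apply: KV.
Qed.

(** Gives a subfield in the sense of sets the structure that the [rpred] lemmas on sums and
    polynomial values expect. *)
Lemma subfield_divringClosed (C : fieldType) (K : set C) :
  is_subfield K -> exists S : divringClosed C, forall x, x \in S <-> K x.
Proof.
move=> KP.
pose S : divringClosed C := HB.pack [in K]
  (GRing.isDivringClosed.Build C [in K] KP).
exists S; by move=> x; rewrite -[x \in _]/(x \in K) inE.
Qed.

Lemma generated_field_subfield (C : fieldType) (A : set C) :
  is_subfield (generated_field A).
Proof.
apply/is_subfieldP; split=> [K [/is_subfieldP[]]//|x y Ax Ay K KP|x y Ax Ay K KP].
- have [/is_subfieldP[_ KB _] _] := KP.
  by apply: KB; [apply: Ax | apply: Ay].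
- have [/is_subfieldP[_ _ KV] _] := KP.
  by apply: KV; [apply: Ax | apply: Ay].
Qed.

Lemma sub_generated_field (C : fieldType) (A : set C) : A `<=` generated_field A.
Proof. exact: sub_smallest. Qed.

Lemma generated_field_min (C : fieldType) (A K : set C) :
  is_subfield K -> A `<=` K -> generated_field A `<=` K.
Proof. exact: smallest_sub. Qed.

Lemma range_subfield (L C : fieldType) (j : {rmorphism L -> C}) :
  is_subfield (range j).
Proof.
apply/is_subfieldP; split=> [|_ _ [x _ <-] [y _ <-]|_ _ [x _ <-] [y _ <-]].
- by exists 1; rewrite ?rmorph1.
- by exists (x - y); rewrite ?rmorphB.
- by exists (x / y); rewrite // rmorphM fmorphV.
Qed.

Section ImageOfSubfield.

Variables (F : fieldType) (E : fieldExtType F) (C : fieldType).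
Variable (j : {rmorphism E -> C}).
Implicit Types (K L : {subfield E}) (P : set C).

Lemma image_subfield K : is_subfield (j @` [set` K]).
Proof.
apply/is_subfieldP; split=> [|_ _ [x Kx <-] [y Ky <-]|_ _ [x Kx <-] [y Ky <-]].
- by exists 1; rewrite ?rmorph1 //= mem1v.
- by exists (x - y); rewrite ?rmorphB //=; apply: rpredB.
- by exists (x / y); rewrite ?rmorphM ?fmorphV //=; apply: rpred_div.
Qed.

Lemma image_adjoin_sub P K x : is_subfield P ->
  j @` [set` K] `<=` P -> P (j x) -> j @` [set` <<K; x>>%VS] `<=` P.
Proof.
move=> PP sKP Px _ [_ /Fadjoin_polyP[q /polyOverP Kq ->] <-].
have [S SE] := subfield_divringClosed PP.
rewrite -horner_map; suffices : (map_poly j q).[j x] \in S by move/SE.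
apply: rpred_horner; last by apply/SE.
apply/polyOverP=> i; rewrite coef_map; apply/SE/sKP.
by exists q`_i => //=; apply: Kq.
Qed.

Lemma image_prodv_sub P K L : is_subfield P ->
  j @` [set` K] `<=` P -> j @` [set` L] `<=` P -> j @` [set` (K * L)%VS] `<=` P.
Proof.
move=> PP sKP sLP _ [x /= KLx <-].
have [S SE] := subfield_divringClosed PP.
suffices : j x \in S by move/SE.
move: KLx; rewrite (unlock (prodv_unlockable E)) => /(@coord_span _ _ _ (in_tuple _)) ->.
rewrite rmorph_sum; apply: rpred_sum => i _.
case/allpairsP: (mem_nth 0 (ltn_ord i)) => -[u v] /= [Ku Lv ->].
rewrite scalerAl rmorphM; apply: rpredM; apply/SE; [apply: sKP | apply: sLP].
  by eexists; last by []; rewrite /= memvZ // vbasis_mem.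
by exists v => //=; apply: vbasis_mem.
Qed.

End ImageOfSubfield.

(** Reduces an inclusion of fields to finitely many elements, a condition that a finite list [s] in
    [galois_hull] can ensure. *)
Lemma range_sub_vbasis (F : fieldType) (C : closedFieldType)
    (iota : {rmorphism F -> C}) (L E : fieldExtType F)
    (jL : {rmorphism L -> C}) (jE : {rmorphism E -> C}) :
  over_base iota jL -> over_base iota jE ->
  (forall y, y \in vbasis {:L} -> range jE (jL y)) -> range jL `<=` range jE.
Proof.
move=> jLF jEF sLE _ [y _ <-].
have [S SE] := subfield_divringClosed (range_subfield jE).
apply/SE; rewrite (coord_vbasis (memvf y)) rmorph_sum.
apply: rpred_sum => i _; rewrite (over_baseZ jLF) rpredM //; apply/SE.
  by rewrite -jEF; exists (coord (vbasis {:L}) i y)%:A.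
by apply/sLE/mem_nth; rewrite size_tuple.
Qed.

(** * Roots of unity and the cyclotomic extension *)

Lemma separable_XnsubC (K : fieldType) (N : nat) (c : K) :
  N%:R != 0 :> K -> c != 0 -> separable_poly ('X^N - c%:P).
Proof.
move=> nzN nzc; have N_gt0 : (0 < N)%N by case: N nzN => //; rewrite eqxx.
rewrite unlock; apply/Bezout_eq1_coprimepP.
(* Bezout relation between the polynomial and its derivative: -c^-1 (X^N - c) + (c^-1 / N) X * N
   X^(N-1) = 1. *)
exists ((- c^-1)%:P, (c^-1 / N%:R) *: 'X).
rewrite derivB derivXn derivC subr0 /= -scalerAl mulrnAr -exprS prednK //.
rewrite -scalerMnr scalerMnl -mulr_natr divfK // mul_polyC scalerBr !scaleNr.
by rewrite addrAC addNr add0r opprK -mul_polyC -polyCM mulVf.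
Qed.

Lemma exists_primitive_root (C : closedFieldType) (N : nat) :
  N%:R != 0 :> C -> exists w : C, N.-primitive_root w.
Proof.
move=> nzN; have N_gt0 : (0 < N)%N by case: N nzN => //; rewrite eqxx.
have [rs Drs] := closed_field_poly_normal ('X^N - 1 : {poly C}).
have lc1 : lead_coef ('X^N - 1 : {poly C}) = 1 by apply/eqP/monic_Xn_sub_1.
rewrite lc1 scale1r in Drs.
have /hasP[w _ w_prim] : has N.-primitive_root rs; last by exists w.
apply: has_prim_root => //.
- apply/allP=> x rs_x; rewrite unity_rootE -subr_eq0.
  by move: rs_x; rewrite -root_prod_XsubC -Drs rootE !hornerE.
- by rewrite -separable_prod_XsubC -Drs separable_Xn_sub_1.
- by rewrite -ltnS -(size_prod_XsubC rs id) -Drs size_Xn_sub_1.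
Qed.

Lemma unity_root_separable_over (F C : fieldType) (iota : {rmorphism F -> C})
    (N : nat) (x : C) :
  N%:R != 0 :> F -> N.-unity_root x -> separable_over iota x.
Proof.
move=> nzN /unity_rootP xN; exists ('X^N - 1); first exact: separable_Xn_sub_1.
by rewrite rmorphB /= map_polyXn rmorph1 rootE !hornerE xN subrr.
Qed.

(** Raising x = 1 mod p to the power p gains one factor p: x^p - 1 is x - 1 times a sum of p terms,
    each congruent to 1 mod p. *)
Lemma dvdn_pred_exp_prime (p m k : nat) :
  (0 < m)%N -> (p %| m.-1)%N -> (p ^ k.+1 %| (m ^ (p ^ k)).-1)%N.
Proof.
move=> m_gt0 p_m; elim: k => [|k IHk]; first by rewrite expn0 !expn1.
set x := (m ^ (p ^ k))%N in IHk.
have x_gt0 : (0 < x)%N by rewrite expn_gt0 m_gt0.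
have p_x : (x = 1 %[mod p])%N.
  apply/eqP; rewrite eqn_mod_dvd // subn1 (dvdn_trans _ IHk) //.
  by rewrite expnS dvdn_mulr.
rewrite [(p ^ k.+1)%N]expnSr expnM -/x predn_exp expnSr dvdn_mul //.
rewrite /dvdn -modn_summ.
under eq_bigr do rewrite -modnXm p_x modnXm exp1n.
by rewrite modn_summ sum1_card card_ord modnn.
Qed.

Lemma gal_generator_eq (F : fieldType) (L : splittingFieldType F)
    (w : L) (g h : gal_of {:L}) :
  <<1; w>>%VS = fullv -> g w = h w -> g = h.
Proof.
move=> gen_w ghw; apply/eqP/gal_eqP=> x _.
have /Fadjoin_polyP[q q1 ->] : x \in <<1; w>>%VS by rewrite gen_w memvf.
have /polyOver1P[r ->] := q1.
rewrite -!horner_map /= ghw -!map_poly_comp; congr _.[_].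
by apply: eq_map_poly => a /=; rewrite !linearZ !rmorph1.
Qed.

Section CyclotomicExtension.

Variables (p n : nat) (F : fieldType) (C : closedFieldType).
Variables (iota : {rmorphism F -> C}) (M : splittingFieldType F).
Variable phi : {rmorphism M -> C}.
Hypotheses (p_prime : prime p) (n_gt0 : (0 < n)%N) (charF : p \notin [pchar F]).
Hypothesis phi_over : over_base iota phi.
Hypothesis M_def : range phi = adjoin (range iota) (@mu C (p ^ n)).

Lemma p_natr_neq0 : p%:R != 0 :> F.
Proof. by apply: contra charF => p0; rewrite inE p_prime. Qed.

Lemma pn_natr_neq0 : (p ^ n)%:R != 0 :> F.
Proof. by rewrite natrX expf_neq0 ?p_natr_neq0. Qed.

Lemma cyclotomic_generator :
  exists2 w : M, (p ^ n).-primitive_root w & <<1; w>>%VS = fullv.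
Proof.
have [|w w_prim] := @exists_primitive_root C (p ^ n).
  by rewrite -(rmorph_nat iota) fmorph_eq0 pn_natr_neq0.
have mu_w : mu (p ^ n) w by apply/unity_rootP/prim_expr_order.
have [w0 _ Dw] : range phi w.
  by rewrite M_def; apply: sub_generated_field; right.
have w0_prim : (p ^ n).-primitive_root w0 by rewrite -(fmorph_primitive_root phi) Dw.
exists w0 => //; apply/vspaceP=> x; rewrite memvf.
suffices: (phi @` [set` <<1; w0>>%VS]) (phi x).
  by case=> y /= Ky /fmorph_inj <-.
have : range phi (phi x) by exists x.
rewrite M_def; apply: generated_field_min.
  exact: (image_subfield phi <<1; w0>>%AS).
move=> z [[a _ <-] | /= /unity_rootP].
  by exists a%:A; rewrite ?phi_over //=; apply: rpredZ; apply: mem1v.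
case/(prim_rootP w_prim) => i ->; exists (w0 ^+ i); last by rewrite rmorphXn /= Dw.
by apply: rpredX; apply: memv_adjoin.
Qed.

Lemma cyclotomic_galois : galois 1 {:M}.
Proof.
have [w w_prim gen_w] := cyclotomic_generator.
apply/and3P; split; [exact: sub1v | | exact: normalFieldf].
rewrite -[X in separable _ X]gen_w -adjoin_separable_eq.
apply/(separable_overE _ phi_over)/(@unity_root_separable_over _ _ _ (p ^ n)).
  exact: pn_natr_neq0.
by rewrite fmorph_unity_root; apply/unity_rootP/prim_expr_order.
Qed.

Lemma unity_root_range z : p.-unity_root z -> range phi z.
Proof.
move=> /unity_rootP zp; rewrite M_def; apply: sub_generated_field; right.
by apply/unity_rootP; rewrite -(prednK n_gt0) expnS exprM zp expr1n.
Qed.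

(** An automorphism of M over F(mu_p) has order a power of p, since it raises [w] to an exponent
    congruent to 1 mod p. Its order also divides [M:F], so it is trivial. *)
Lemma cyclotomic_generator_p (pdegM : ~~ (p %| \dim {:M})%N) :
  exists2 z : M, p.-unity_root z & <<1; z>>%VS = fullv.
Proof.
have [w w_prim gen_w] := cyclotomic_generator.
have wpn : w ^+ (p ^ n) = 1 := prim_expr_order w_prim.
pose z := w ^+ (p ^ n.-1); exists z.
  by apply/unity_rootP; rewrite -exprM -expnSr prednK.
have galK : galois <<1; z>> {:M}.
  by apply: galoisS cyclotomic_galois; rewrite sub1v subvf.
rewrite -(galois_fixedField galK) /=.
suffices -> : 'Gal({:M} / <<1; z>>)%g = 1%g.
  apply/vspaceP=> x; rewrite memvf; apply/fixedFieldP; first exact: memvf.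
  by move=> g /set1P ->; rewrite gal_id.
apply/trivgP/fintype.subsetP=> g gG; rewrite inE -order_eq1.
have g1 : g \in 'Gal({:M} / 1)%g by apply: (fintype.subsetP _ _ gG); rewrite galS ?sub1v.
have [a Da] : exists a, g w = w ^+ a.
  have [|a ->] := prim_rootP w_prim (x := g w).
    by rewrite -rmorphXn /= wpn rmorph1.
  by exists a.
have gz : g z = z.
  by apply: fixed_gal gG _; rewrite ?subvf // memv_adjoin.
have z_prim : p.-primitive_root z.
  (* The order of w^(p^(n-1)) is p^n / gcd(p^(n-1), p^n) = p. *)
  rewrite (_ : p = p ^ n %/ gcdn (p ^ n.-1) (p ^ n))%N; first exact: exp_prim_root.
  rewrite -[in X in gcdn _ X](prednK n_gt0) expnSr gcdnMr -(prednK n_gt0) expnSr.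
  by rewrite mulKn // expn_gt0 prime_gt0.
have ap : (a == 1 %[mod p])%N.
  by rewrite -(eq_prim_root_expr z_prim) expr1 -exprM mulnC exprM -Da -rmorphXn /= -/z gz.
have a_gt0 : (0 < a)%N.
  by case: a ap {Da} => //; rewrite mod0n modn_small ?prime_gt1.
have gX k : (g ^+ k)%g w = w ^+ (a ^ k).
  elim: k => [|k IHk]; first by rewrite gal_id expn0 expr1.
  by rewrite expgSr galM ?memvf // IHk rmorphXn /= Da -exprM expnS.
have /eqP gpn : (g ^+ (p ^ n.-1))%g == 1%g.
  apply/eqP/(gal_generator_eq gen_w); rewrite gX gal_id -[RHS]expr1; apply/eqP.
  rewrite (eq_prim_root_expr w_prim) eqn_mod_dvd ?expn_gt0 ?a_gt0 // subn1.
  rewrite -{1}(prednK n_gt0) dvdn_pred_exp_prime //.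
  by rewrite -subn1 -eqn_mod_dvd.
(* The order of [g] divides both a power of p and a number prime to p, so it is coprime to itself,
   hence 1. *)
have: coprime #[g]%g #[g]%g; last by rewrite /coprime gcdnn.
have dg1 : (#[g]%g %| p ^ n.-1)%N by rewrite order_dvdn gpn.
have dg2 : (#[g]%g %| \dim {:M})%N.
  have := galois_dim cyclotomic_galois; rewrite /= dimv1 divn1 => ->.
  exact: order_dvdG.
apply: coprime_dvdl dg1 _; apply: coprime_dvdr dg2 _.
by rewrite coprimeXl // prime_coprime.
Qed.

End CyclotomicExtension.

(** * Powers of automorphisms and commutation on p-extensions *)

Lemma iter_galX (F : fieldType) (L : splittingFieldType F) (E : {subfield L})
    (g : gal_of E) k x :
  x \in E -> iter k g x = (g ^+ k)%g x.
Proof.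
move=> Ex; elim: k => [|k IHk] /=; first by rewrite gal_id.
by rewrite IHk expgSr galM.
Qed.

(* A finite substitute for the compositum of all p-extensions: [s] makes [E]
   large enough to see [x], and [p ^ N] is a common multiple of the degrees of
   the p-extensions involved in [x], so that [h ^ (p ^ N * c)] is trivial on
   them. *)
Definition power_commuting (F : fieldType) (C : closedFieldType)
    (iota : {rmorphism F -> C}) (p : nat) : set C :=
  [set x | exists (s : seq C) (N : nat),
    (forall y, y \in s -> separable_over iota y) /\
    forall (E : splittingFieldType F) (j : {rmorphism E -> C}),
      over_base iota j -> (forall y, y \in s -> range j y) ->
      exists2 y : E, j y = x &
        forall (h tau : 'AEnd(E)) (c : nat),
          (forall z : E, z ^+ p = 1 -> tau z = z) ->
          tau (iter (p ^ N * c) h y) = iter (p ^ N * c) h (tau y)].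

Section PowerCommuting.

Variables (F : fieldType) (C : closedFieldType) (iota : {rmorphism F -> C}).
Variable p : nat.

(** Treats subtraction and division at once: only compatibility of [op] with field morphisms
    matters. The two lists are concatenated and the exponents [N1], [N2] added. *)
Lemma power_commuting_op (op : forall K : fieldType, K -> K -> K) :
  (forall (K1 K2 : fieldType) (u : {rmorphism K1 -> K2}),
     {morph u : x y / op _ x y}) ->
  forall x y, power_commuting iota p x -> power_commuting iota p y ->
  power_commuting iota p (op _ x y).
Proof.
move=> opM x1 x2 [s1 [N1 [sep1 W1]]] [s2 [N2 [sep2 W2]]].
exists (s1 ++ s2), (N1 + N2)%N; split=> [y|E j jF s_j].
  by rewrite mem_cat => /orP[/sep1 | /sep2].
have [|y1 <- comm1] := W1 E j jF.
  by move=> y sy; apply: s_j; rewrite mem_cat sy.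
have [|y2 <- comm2] := W2 E j jF.
  by move=> y sy; apply: s_j; rewrite mem_cat sy orbT.
exists (op _ y1 y2) => [|h tau c tau_p]; first by rewrite opM.
have iterM k y z : iter k h (op _ y z) = op _ (iter k h y) (iter k h z).
  by elim: k => //= k ->; rewrite opM.
rewrite !opM !iterM !opM; congr op.
  (* The surplus factor p^N2 is absorbed into the arbitrary multiplier [c]. *)
  by rewrite expnD -mulnA; apply: comm1.
by rewrite [(N1 + N2)%N]addnC expnD -mulnA; apply: comm2.
Qed.

Lemma power_commuting_subfield : is_subfield (power_commuting iota p).
Proof.
apply/is_subfieldP; split.
- exists [::], 0%N; split=> // E j jF _; exists 1; first by rewrite rmorph1.
  move=> h tau c _; suffices iter1 k : iter k h 1 = 1 by rewrite rmorph1 iter1 rmorph1.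
  by elim: k => //= k ->; rewrite rmorph1.
- by apply: (power_commuting_op (op := fun K x y => x - y)) => K1 K2 u x y; rewrite rmorphB.
- by apply: (power_commuting_op (op := fun K x y => x / y)) => K1 K2 u x y; rewrite rmorphM fmorphV.
Qed.

(** [N] = 0 suffices: every iterate of [h] sends [y] to a p-th root of unity, and [tau] fixes all of
    these. *)
Lemma unity_root_power_commuting x :
  p%:R != 0 :> F -> mu p x -> power_commuting iota p x.
Proof.
move=> p_neq0 mu_x; exists [:: x], 0%N; split=> [y|E j jF s_j].
  by rewrite inE => /eqP->; apply: unity_root_separable_over mu_x.
have [|y _ Dy] := s_j x; first exact: mem_head.
exists y => // h tau c tau_p.
have yp : y ^+ p = 1.
  by apply: (fmorph_inj j); rewrite rmorphXn rmorph1 /= Dy; apply/unity_rootP.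
have hyp k : iter k h y ^+ p = 1.
  by elim: k => //= k IHk; rewrite -rmorphXn IHk rmorph1.
by rewrite !tau_p.
Qed.

(** [h] restricts to an element of a Galois group of order p^k, so its power of exponent p^k * c is
    trivial on the whole extension. *)
Lemma galois_ext_power_commuting k E :
  galois_ext iota (p ^ k) E -> E `<=` power_commuting iota p.
Proof.
case=> L [jL [jLF <- galL dimL]] _ [x _ <-].
exists (map jL (vbasis {:L})), k; split=> [_ /mapP[y _ ->]|{}E j jF s_j].
  apply/(separable_overE _ jLF).
  by have /and3P[_ /separableP sepL _] := galL; apply: sepL; apply: memvf.
have [|f Df] := embedding_over_base jLF jF.
  by apply: (range_sub_vbasis jLF jF) => y Ly; apply/s_j/map_f.
exists (f x) => // h tau c _.
have fix_f y : iter (p ^ k * c) h (f y) = f y.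
  have [s sG Ds] := restrict_automorphism f h.
  have iter_f e : iter e h (f y) = f (iter e s y).
    by elim: e => //= e ->; rewrite Ds.
  rewrite iter_f iter_galX ?memvf //; suffices -> : (s ^+ (p ^ k * c) = 1)%g by rewrite gal_id.
  apply/eqP; rewrite -order_dvdn dvdn_mulr // -dimL.
  have := galois_dim galL; rewrite /= dimv1 divn1 => ->.
  exact: order_dvdG.
(* By normality [tau] keeps [f x] in the image of [f], where the power of [h] is trivial as well. *)
have [s _ Ds] := restrict_automorphism f tau.
by rewrite fix_f -Ds fix_f.
Qed.

Lemma max_p_ext_power_commuting :
  p%:R != 0 :> F -> adjoin (max_p_ext iota p) (@mu C p) `<=` power_commuting iota p.
Proof.
move=> p_neq0; apply: generated_field_min; first exact: power_commuting_subfield.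
move=> x [|]; last exact: unity_root_power_commuting.
apply: generated_field_min; first exact: power_commuting_subfield.
by move=> y [E [k galE] Ey]; apply: galois_ext_power_commuting galE y Ey.
Qed.

End PowerCommuting.

(** * From the inclusion in [J] to the twisted class of [m] *)

Lemma galois_hull_over (F : fieldType) (C : closedFieldType)
    (iota : {rmorphism F -> C}) (L : fieldExtType F)
    (jL : {rmorphism L -> C}) (s : seq C) :
  over_base iota jL -> separable 1 {:L} ->
  (forall x, x \in s -> separable_over iota x) ->
  exists (E : splittingFieldType F) (j : {rmorphism E -> C}) (f : 'AHom(L, E)),
    [/\ over_base iota j, galois 1 {:E}, forall x, j (f x) = jL x
      & forall x, x \in s -> range j x].
Proof.
move=> jLF /separableP sepL sep_s.
have [|E [j [jF galE s_j]]] := @galois_hull F C iota (map jL (vbasis {:L}) ++ s).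
  move=> x; rewrite mem_cat => /orP[/mapP[y _ ->] | /sep_s//].
  by apply/(separable_overE _ jLF)/sepL/memvf.
have [|f Df] := embedding_over_base jLF jF.
  apply: (range_sub_vbasis jLF jF) => y Ly; apply: s_j.
  by rewrite mem_cat map_f.
exists E, j, f; split=> // x sx.
by apply: s_j; rewrite mem_cat sx orbT.
Qed.

(** X^N - m is separable over the image of [L], which is separable over [F]; separability is
    transitive. *)
Lemma separable_over_radical (F : fieldType) (C : closedFieldType)
    (iota : {rmorphism F -> C}) (L : fieldExtType F) (jL : {rmorphism L -> C})
    (N : nat) (m : L) (t : C) :
  algebraic_closure iota -> over_base iota jL -> separable 1 {:L} ->
  N%:R != 0 :> F -> m != 0 -> t ^+ N = jL m -> separable_over iota t.
Proof.
move=> algC jLF /separableP sepL nzN nzm tN.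
(* As separability of [t] is still to be shown, [E] is only a finite extension, obtained from
   algebraicity. *)
have [//|E [j [s [jF Ds _]]]] :=
  @finite_subextension F C iota (t :: map jL (vbasis {:L})).
have s_j x : x \in t :: map jL (vbasis {:L}) -> range j x.
  by rewrite -Ds => /mapP[y _ ->]; exists y.
have [|f Df] := embedding_over_base jLF jF.
  by apply: (range_sub_vbasis jLF jF) => y Ly; apply: s_j; rewrite inE map_f ?orbT.
have [|t0 _ Dt] := s_j t; first exact: mem_head.
rewrite -Dt; apply/(separable_overE _ jF).
have t0N : t0 ^+ N = f m.
  by apply: (fmorph_inj j); rewrite rmorphXn /= Dt tN Df.
pose K := [aspace of limg f].
have sepK : separable 1 K.
  apply/separableP=> _ /memv_imgP[x _ ->]; apply/(separable_overE _ jF).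
  by rewrite Df; apply/(separable_overE _ jLF)/sepL/memvf.
have sepKt : separable K <<K; t0>>.
  rewrite -adjoin_separable_eq; apply/separable_elementP.
  exists ('X^N - (f m)%:P); split.
  - by rewrite polyOverXnsubC memv_img ?memvf.
  - by rewrite rootE !hornerE t0N subrr.
  - apply: separable_XnsubC; last by rewrite fmorph_eq0.
    by rewrite -(rmorph_nat (in_alg E)) fmorph_eq0.
have /separableP := separable_trans sepK sepKt; apply; exact: memv_adjoin.
Qed.

(** The implication from (2) to (3), with a natural number [a] describing the action of [g] on the
    p^n-th roots of unity. *)
Lemma twisted_class_of_sub (p n : nat) (F : fieldType) (C : closedFieldType)
    (iota : {rmorphism F -> C}) (M : splittingFieldType F)
    (phi : {rmorphism M -> C}) (m : M) (t : C) :
  prime p -> (0 < n)%N -> algebraic_closure iota -> p \notin [pchar F] ->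
  over_base iota phi -> range phi = adjoin (range iota) (@mu C (p ^ n)) ->
  ~~ (p %| \dim {:M})%N -> m != 0 -> t ^+ (p ^ n) = phi m ->
  adjoin (max_p_ext iota p) (@mu C p) t ->
  forall g : gal_of {:M}, g \in 'Gal({:M} / 1%VS)%g ->
  forall a : nat, (forall w : M, mu (p ^ n) w -> g w = w ^+ a) ->
  exists2 u : M, u != 0 & g m = m ^+ a * u ^+ (p ^ n).
Proof.
move=> p_prime n_gt0 algC charF phiF M_def degM nzm tpn Jt g gG a ga.
have galM := cyclotomic_galois p_prime charF phiF M_def.
have /and3P[_ sepM _] := galM.
have p_neq0 := p_natr_neq0 p_prime charF.
have sep_t : separable_over iota t.
  exact: (separable_over_radical algC phiF sepM (pn_natr_neq0 n p_prime charF) nzm tpn).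
have [s [N [sep_s comm]]] := max_p_ext_power_commuting p_neq0 Jt.
have [E [j [f [jF galE Df s_j]]]] := galois_hull_over phiF sepM sep_s.
have [t0 Dt {}comm] := comm E j jF s_j.
have t0pn : t0 ^+ (p ^ n) = f m.
  by apply: (fmorph_inj j); rewrite rmorphXn /= Dt tpn Df.
have nz_t0 : t0 != 0.
  apply: contraNneq nzm => t00; rewrite -(fmorph_eq0 f) /= -t0pn t00.
  by rewrite expr0n expn_eq0 -(prednK (prime_gt0 p_prime)).
have [h hG Dh] := lift_automorphism f g.
have [w w_prim _] := cyclotomic_generator p_prime charF phiF M_def.
(* [h ^+ e] is trivial on the p-extensions involved in [t] but restricts to
   [g] on [M]. *)
pose e := ((p ^ N) ^ totient #[g]%g)%N; pose sg := (h ^+ e)%g.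
have De : e = (p ^ N * (p ^ N) ^ (totient #[g]%g).-1)%N.
  by rewrite -expnS prednK // totient_gt0 order_gt0.
have sgM x : sg (f x) = f (g x).
  (* The order of [g] divides [M:F], so it is prime to p, and Euler's theorem gives e = 1 modulo
     this order. *)
  have ->: g = (g ^+ e)%g.
    apply/eqP; rewrite -[X in X == _]expg1 eq_expg_mod_order eq_sym.
    apply/eqP/Euler_exp_totient; apply: coprimeXl; rewrite prime_coprime //.
    apply: contra degM => /dvdn_trans; apply.
    have := galois_dim galM; rewrite /= dimv1 divn1 => ->.
    exact: order_dvdG.
  by rewrite -!iter_galX ?memvf //; elim: e {sg De} => //= k ->; rewrite Dh.
pose K := [aspace of limg f].
have : sg t0 / t0 ^+ a \in K.
  have galK : galois K {:E} by apply: galoisS galE; rewrite sub1v subvf.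
  rewrite -(galois_fixedField galK); apply/fixedFieldP=> [|tau tauK].
    exact: memvf.
  have tau_f x : tau (f x) = f x.
    by apply: (fixed_gal _ tauK); rewrite ?subvf ?memv_img ?memvf.
  have tau_sg : tau (sg t0) = sg (tau t0).
    rewrite /sg -!iter_galX ?memvf // De; apply: comm => z zp.
    (* The p-th roots of unity lie in M, hence are fixed by [tau], as [comm] demands. *)
    have [|x _ Dx] := @unity_root_range p n F C iota M phi n_gt0 M_def (j z).
      by apply/unity_rootP; rewrite -rmorphXn zp rmorph1.
    by have <- : f x = z by apply: (fmorph_inj j); rewrite Df.
  have [z zN Dz] : exists2 z : M, mu (p ^ n) z & tau t0 = f z * t0.
    have fw_prim : (p ^ n).-primitive_root (f w) by rewrite fmorph_primitive_root.
    have [|i Di] := prim_rootP fw_prim (x := tau t0 / t0).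
      by rewrite expr_div_n -rmorphXn /= t0pn tau_f divff // fmorph_eq0.
    exists (w ^+ i); last by rewrite rmorphXn -Di divfK.
    by apply/unity_rootP; rewrite exprAC (prim_expr_order w_prim) expr1n.
  have nz_z : f z ^+ a != 0.
    rewrite expf_neq0 // fmorph_eq0; apply/eqP=> z0.
    have /unity_rootP/eqP := zN; rewrite z0 expr0n expn_eq0.
    by rewrite -(prednK (prime_gt0 p_prime)) /= eq_sym oner_eq0.
  (* Since [sg] raises [f z] to the power [a], [tau] multiplies numerator and denominator by the
     same factor (f z)^a. *)
  rewrite fmorph_div /= tau_sg rmorphXn /= Dz rmorphM /= sgM ga //.
  by rewrite rmorphXn /= exprMn -mulf_div divff // mul1r.
case/memv_imgP=> u _ Du; exists u.
  by rewrite -(fmorph_eq0 f) /= -Du mulf_neq0 ?invr_eq0 ?expf_neq0 ?fmorph_eq0.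
apply: (fmorph_inj f); rewrite rmorphM /= !rmorphXn /= -sgM -Du -t0pn rmorphXn /=.
by rewrite expr_div_n -!exprM [(a * _)%N]mulnC mulrC divfK // expf_neq0.
Qed.

(** * Construction of the cyclic extension *)

(** [cyclic_ext] asks for a splitting field in its own right, so [S] is repackaged as one, and a
    generator of its Galois group is carried over through the inclusion [f]. *)
Lemma cyclic_ext_of_subfield (F : fieldType) (C : closedFieldType)
    (iota : {rmorphism F -> C}) (E : splittingFieldType F)
    (j : {rmorphism E -> C}) (S : {subfield E}) :
  over_base iota j -> galois 1 S -> cyclic 'Gal(S / 1%VS)%g ->
  cyclic_ext iota (\dim S) (j @` [set` S]).
Proof.
move=> jF galS cycS; have /and3P[_ sepS normS] := galS.
have val_ahom : ahom_in {:subvs_of S} (linfun vsval).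
  by apply/ahom_inP; split=> [x y _ _|]; rewrite !lfunE ?rmorphM ?rmorph1.
pose f : 'AHom(subvs_of S, E) := AHom val_ahom.
have fE x : f x = vsval x by rewrite lfunE.
have limgf : limg f = S.
  apply/vspaceP=> x; apply/memv_imgP/idP=> [[y _ ->] | Sx].
    by rewrite fE subvsP.
  by exists (vsproj S x); rewrite ?memvf // fE vsprojK.
(* Normality makes [S] the splitting field of a polynomial over [F]; its roots are pulled back to
   [subvs_of S]. *)
have splitS : splitting_field_axiom (subvs_of S).
  have /(splitting_normalField (sub1v S))[P P1 [rs DP gen_rs]] := normS.
  have /polyOver1P[q Dq] := P1.
  pose rs' := map (vsproj S) rs.
  have Drs : map f rs' = rs.
    rewrite -map_comp -[RHS]map_id; apply/eq_in_map=> z rs_z /=.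
    rewrite fE vsprojK // -gen_rs; exact: seqv_sub_adjoin.
  exists (map_poly (in_alg (subvs_of S)) q); first by apply/polyOver1P; exists q.
  exists rs'.
    rewrite -(eqp_map f) -map_poly_comp.
    rewrite (eq_map_poly (g := in_alg E)); last by move=> a; rewrite /= linearZ rmorph1.
    rewrite -Dq (eqp_ltrans DP) rmorph_prod -Drs big_map.
    under [X in _ %= X]eq_bigr do rewrite rmorphB /= map_polyX map_polyC.
    exact: eqpxx.
  apply/vspaceP=> x; rewrite memvf.
  have : f x \in (f @: <<1 & rs'>>)%VS.
    by rewrite aimg_adjoin_seq aimg1 Drs gen_rs fE subvsP.
  by case/memv_imgP=> y rs'y /fmorph_inj->.
pose L : splittingFieldType F :=
  HB.pack (subvs_of S) (FieldExt_isSplittingField.Build F (subvs_of S) splitS).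
pose fL : 'AHom(L, E) := f.
pose jL : {rmorphism L -> C} := j \o fL.
have fLE (x : L) : fL x = vsval x := fE x.
have fLS (x : L) : fL x \in S by rewrite fLE subvsP.
have jLF : over_base iota jL.
  by move=> a; rewrite /= linearZ rmorph1 jF.
exists L, jL; split=> //.
- apply/seteqP; split=> [_ [x _ <-] | _ [x /= Sx <-]].
    by exists (fL x) => //=; apply: fLS.
  by exists (vsproj S x) => //=; rewrite fLE vsprojK.
- apply/and3P; split; [exact: sub1v | | exact: normalFieldf].
  apply/separableP=> x _; apply/(separable_overE _ jLF)/(separable_overE _ jF).
  by have /separableP := sepS; apply; apply: fLS.
- have /cyclicP[g Dg] := cycS.
  have [s sG Ds] := restrict_automorphism fL g.
  apply/cyclicP; exists s; apply/eqP; rewrite finset.eqEsubset cycle_subG sG andbT.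
  (* Each [r] lifts to an automorphism [h] of [E], whose restriction to [S] is a power of [g]; hence
     [r] is the same power of [s]. *)
  apply/fintype.subsetP=> r rG.
  have [h hG Dh] := lift_automorphism fL r.
  have hS : (h @: S <= S)%VS.
    apply/subvP=> _ /memv_imgP[x Sx ->].
    by rewrite -(vsprojK Sx) -(fLE (vsproj S x)) Dh fLS.
  have : gal S h \in <[g]>%g by rewrite -Dg gal_kHom ?sub1v ?k1AHom.
  case/cycleP=> k Dk; apply/cycleP; exists k; apply/eqP/gal_eqP=> x _.
  apply: (fmorph_inj fL); rewrite /= -Dh -(galK hS) ?fLS // Dk.
  rewrite -!iter_galX ?fLS ?memvf //.
  by elim: k {Dk} => //= k ->; rewrite Ds.
- rewrite -limgf; apply/esym/limg_dim_eq/eqP.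
  by have /eqP-> := AHom_lker0 fL; rewrite capv0.
Qed.

(** The Schur-Zassenhaus complement [B] lies in [G], so it centralises [A]; being normalised by both
    [A] and itself, it is normal in [G]. *)
Lemma central_Hall_complement (gT : finGroupType) (G A : {group gT}) :
  Hall G A -> G \subset 'C(A)%g ->
  exists B : {group gT}, [/\ (A :&: B = 1)%g, (A * B)%g = G & (B <| G)%g].
Proof.
move=> hallA cGA; have /andP[sAG _] := hallA.
have nsAG : (A <| G)%g by rewrite /normal sAG cents_norm.
have /splitsP[B /complP[tiAB defG]] := SchurZassenhaus_split hallA nsAG.
exists B; split=> //; have sBG : B \subset G by rewrite -defG mulG_subr.
rewrite /normal sBG -defG mulG_subG normG andbT cents_norm // centsC.
exact: fintype.subset_trans sBG cGA.
Qed.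

(** The implication from (3) to (1), carried out in a Galois hull [E]: [K] is the copy of M in it
    and [T] the field generated by [t0] over [K]. *)
Lemma cyclic_descent (p n : nat) (F : fieldType) (C : closedFieldType)
    (iota : {rmorphism F -> C}) (M : splittingFieldType F)
    (phi : {rmorphism M -> C}) (m : M) (t : C) :
  prime p -> (0 < n)%N -> algebraic_closure iota -> p \notin [pchar F] ->
  over_base iota phi -> range phi = adjoin (range iota) (@mu C (p ^ n)) ->
  ~~ (p %| \dim {:M})%N -> m != 0 -> (~ exists z : M, m = z ^+ p) ->
  t ^+ (p ^ n) = phi m ->
  (forall g : gal_of {:M}, g \in 'Gal({:M} / 1%VS)%g ->
   exists (a : nat) (u : M), (forall w : M, mu (p ^ n) w -> g w = w ^+ a) /\
     g m = m ^+ a * u ^+ (p ^ n)) ->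
  exists2 S : set C, cyclic_ext iota (p ^ n) S &
    adjoin (range phi) [set t] = compositum S (range phi).
Proof.
move=> p_prime n_gt0 algC charF phiF M_def degM nzm m_npow tpn twist.
have galMF := cyclotomic_galois p_prime charF phiF M_def.
have /and3P[_ sepM _] := galMF.
have sep_t : separable_over iota t.
  exact: (separable_over_radical algC phiF sepM (pn_natr_neq0 n p_prime charF) nzm tpn).
have [|E [j [f [jF galE Df s_j]]]] := galois_hull_over (s := [:: t]) phiF sepM.
  by move=> x; rewrite mem_seq1 => /eqP->.
have [|t0 _ Dt] := s_j t; first exact: mem_head.
have [w w_prim _] := cyclotomic_generator p_prime charF phiF M_def.
have fw_prim : (p ^ n).-primitive_root (f w) by rewrite fmorph_primitive_root.
have t0pn : t0 ^+ (p ^ n) = f m.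
  by apply: (fmorph_inj j); rewrite rmorphXn /= Dt tpn Df.
have pn_gt0 : (0 < p ^ n)%N by rewrite expn_gt0 prime_gt0.
have nz_t0 : t0 != 0.
  apply: contraNneq nzm => t00; rewrite -(fmorph_eq0 f) /= -t0pn t00.
  by rewrite expr0n gtn_eqF.
pose K := [aspace of limg f]; pose T := <<K; t0>>%AS.
have fK x : f x \in K by rewrite memv_img ?memvf.
have sKT : (K <= T)%VS := subv_adjoin K t0.
have Tt0 : t0 \in T := memv_adjoin K t0.
(* The p^n-th powers of [x t0] and [f u * t0 ^+ a] agree, so their quotient is a root of unity,
   which [v] absorbs. The same [a] governs the roots of unity and [t0]. *)
have action (x : 'AEnd(E)) : exists (s : gal_of {:M}) (a : nat) (v : M),
    [/\ forall y, x (f y) = f (s y), forall z, mu (p ^ n) z -> s z = z ^+ a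
      & x t0 = f v * t0 ^+ a].
  have [s sG Ds] := restrict_automorphism f x.
  have [a [u [sa Du]]] := twist s sG; exists s, a.
  have nz_u : f u != 0.
    rewrite fmorph_eq0; apply/eqP=> u0; move: Du; rewrite u0 expr0n gtn_eqF //.
    by rewrite mulr0 => /eqP; rewrite fmorph_eq0 (negPf nzm).
  have [|i Di] := prim_rootP fw_prim (x := x t0 / (f u * t0 ^+ a)).
    rewrite expr_div_n -rmorphXn /= t0pn -Ds Du exprMn -!exprM.
    rewrite mulnC exprM t0pn rmorphM /= !rmorphXn /= [X in _ / X]mulrC divff //.
    by rewrite mulf_neq0 ?expf_neq0 // fmorph_eq0.
  exists (w ^+ i * u); split=> //.
  by rewrite rmorphM rmorphXn /= -Di -mulrA divfK // mulf_neq0 ?expf_neq0.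
have galT : galois 1 T.
  apply/and3P; split; first exact: sub1v.
    by have /and3P[_ sepE _] := galE; apply: separableSr sepE; apply: subvf.
  apply/forallP=> x; apply/implyP=> _.
  suffices: kAut 1 T x by case/andP.
  rewrite kAut1E; apply/subvP=> _ /memv_imgP[_ /Fadjoin_polyP[q /polyOverP Kq ->] ->].
  have [s [a [v [Ds _ Dv]]]] := action x.
  rewrite -horner_map /= Dv; apply: rpred_horner.
    apply/polyOverP=> i; rewrite coef_map; have /memv_imgP[y _ ->] := Kq i.
    by apply: (subvP sKT); rewrite /= Ds.
  by rewrite rpredM ?rpredX //; apply: (subvP sKT).
have galKT : galois K T by apply: galoisS galT; rewrite sub1v sKT.
pose G := 'Gal(T / 1%VS)%G; pose A := 'Gal(T / K)%G.
have sAG : A \subset G by apply: galS; apply: sub1v.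
have A_f (x : gal_of T) y : x \in A -> x (f y) = f y.
  by move=> Ax; apply: (fixed_gal sKT Ax).
(* Take [tau] in [A] moving r = t0^(p^(n-1)). If none did, r would lie in [K] and [m] would be a
   p-th power in M. *)
have [tau Atau [z z_prim Dtau]] : exists2 tau : gal_of T, tau \in A &
    exists2 z : M, (p ^ n).-primitive_root z & tau t0 = f z * t0.
  pose r := t0 ^+ (p ^ n.-1).
  case: (pickP [pred x : gal_of T | (x \in A) && (x r != r)]) => [tau | fix_r].
    case/andP=> Atau tau_r; exists tau => //.
    have [|i Di] := prim_rootP fw_prim (x := tau t0 / t0).
      by rewrite expr_div_n -rmorphXn /= t0pn A_f // divff // fmorph_eq0.
    have Dtau : tau t0 = f (w ^+ i) * t0 by rewrite rmorphXn -Di divfK.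
    exists (w ^+ i) => //.
    have wiN : (w ^+ i) ^+ (p ^ n) = 1.
      by rewrite exprAC (prim_expr_order w_prim) expr1n.
    have [d d_prim] := prim_order_exists pn_gt0 wiN.
    (* The multiplier of [t0] has order p^k; for k < n its power of exponent p^(n-1) is 1, and [tau]
       would fix [r]. *)
    case/(dvdn_pfactor _ _ p_prime) => k le_kn Dd; rewrite {d}Dd in d_prim.
    have [lt_kn | le_nk] := ltnP k n; last first.
      by rewrite (_ : k = n) in d_prim => //; apply: anti_leq; rewrite le_kn.
    case/eqP: tau_r; rewrite /r rmorphXn /= Dtau exprMn -rmorphXn /=.
    rewrite -(subnKC (_ : k <= n.-1)%N) ?expnD ?exprM; last by rewrite -ltnS prednK.
    by rewrite (prim_expr_order d_prim) expr1n rmorph1 mul1r.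
  have : r \in K.
    rewrite -(galois_fixedField galKT); apply/fixedFieldP=> [|x Ax].
      by rewrite rpredX.
    by have := fix_r x; rewrite /= Ax => /negbFE/eqP.
  case/memv_imgP=> y _ Dy; case: m_npow; exists y.
  by apply: (fmorph_inj f); rewrite rmorphXn /= -Dy -exprM -expnSr prednK.
have fz_prim : (p ^ n).-primitive_root (f z) by rewrite fmorph_primitive_root.
have tauX k : (tau ^+ k)%g t0 = f z ^+ k * t0.
  rewrite -iter_galX //; elim: k => [|k IHk]; first by rewrite mul1r.
  by rewrite /= IHk rmorphM rmorphXn /= A_f // Dtau exprSr mulrA.
have defA : A :=: <[tau]>%g.
  apply/eqP; rewrite finset.eqEsubset cycle_subG Atau andbT.
  apply/fintype.subsetP=> x Ax.
  have [|i Di] := prim_rootP fz_prim (x := x t0 / t0).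
    by rewrite expr_div_n -rmorphXn /= t0pn A_f // divff // fmorph_eq0.
  apply/cycleP; exists i; apply/eqP; rewrite (gal_adjoin_eq Ax) ?groupX //.
  by rewrite tauX -Di divfK.
have oA : #|A| = (p ^ n)%N.
  have tau1 k : (tau ^+ k == 1)%g = (p ^ n %| k)%N.
    rewrite (gal_adjoin_eq (groupX k Atau) (group1 A)) tauX gal_id.
    rewrite (prim_order_dvd fz_prim) -[in RHS](inj_eq (mulIf nz_t0)) mul1r.
    by [].
  apply/eqP; rewrite defA -orderE eqn_dvd order_dvdn tau1 dvdnn.
  by rewrite -tau1 expg_order eqxx.
(* Commutation with [tau] is checked on [K] and on [t0]. On [t0] both composites equal f v * (f z)^a
   * t0^a, because [x] acts on [z] with the exponent that it puts on [t0]. *)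
have cGA : G \subset 'C(A)%g.
  rewrite defA cent_cycle; apply/fintype.subsetP=> x Gx.
  apply/cent1P/eqP/gal_eqP=> _ /Fadjoin_polyP[q /polyOverP Kq ->].
  have [s [a [v [Ds sa Dv]]]] := action x.
  have Tq : q.[t0] \in T.
    by apply/Fadjoin_polyP; exists q => //; apply/polyOverP.
  have comm_f y : tau (x (f y)) = x (tau (f y)) by rewrite Ds !(A_f tau) // Ds.
  have comm_t : tau (x t0) = x (tau t0).
    rewrite Dtau Dv !rmorphM !rmorphXn /= Dtau Ds A_f // sa.
      by rewrite Dv exprMn rmorphXn mulrCA.
    exact/unity_rootP/prim_expr_order.
  rewrite !galM // -!horner_map -!map_poly_comp; congr _.[_]; last exact: comm_t.
  apply/polyP=> i; rewrite !coef_map; have /memv_imgP[y _ ->] := Kq i.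
  exact: comm_f.
(* The index of [A] in [G] is [K:F] = [M:F], prime to p, while [A] has order p^n. *)
have hallA : Hall G A.
  rewrite /Hall sAG -divgS // -(galois_dim galT) /= dimv1 divn1.
  rewrite -(divnK (field_dimS sKT)) (galois_dim galKT) mulKn ?cardG_gt0 //.
  rewrite oA coprimeXl // prime_coprime // limg_dim_eq //.
  by have /eqP-> := AHom_lker0 f; rewrite capv0.
have [B [tiAB defG nsBG]] := central_Hall_complement hallA cGA.
have sBG : B \subset G := normal_sub nsBG.
pose S := [aspace of fixedField B].
have galFS : galois 1 S by exact: (normal_fixedField_galois galT nsBG).
have sST : (S <= T)%VS := fixedField_bound B.
(* Gal(S/F) is isomorphic to G/B = AB/B, a quotient of the cyclic group [A]. *)
have cycS : cyclic 'Gal(S / 1%VS)%g.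
  have /and3P[_ _ normS] := galFS.
  have := normalField_isog galT (M := S) _ normS.
  rewrite sub1v sST => /(_ isT)/isog_cyclic <-.
  rewrite /= gal_fixedField -[galoisG _ _]/(G : {set _}) -defG quotientMidr.
  by rewrite quotient_cyclic // defA cycle_cyclic.
have dimS : \dim S = (p ^ n)%N.
  have := dim_fixed_galois galT sBG; rewrite /= dimv1 divn1 => ->.
  by rewrite -divgS // -[#|_|]/#|G| -defG (TI_cardMg tiAB) mulnK ?cardG_gt0.
(* An automorphism of [T] fixing both [S] and [K] lies in the trivial intersection of [A] and [B],
   so [T] is generated by [S] and [K]. *)
have SKt0 : t0 \in (S * K)%AS.
  have sP : ((S * K)%AS <= T)%VS by apply: prodv_sub.
  have galP : galois (S * K)%AS T by apply: galoisS galT; rewrite sub1v.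
  rewrite -(galois_fixedField galP); apply/fixedFieldP=> // x Px.
  suffices /set1P-> : x \in (1 : {set gal_of T})%g by rewrite gal_id.
  rewrite -tiAB inE; apply/andP; split.
    by apply: (fintype.subsetP _ _ Px); apply/galS/field_subvMl.
  rewrite -(gal_fixedField B).
  by apply: (fintype.subsetP _ _ Px); apply/galS/field_subvMr.
exists (j @` [set` S]).
  by rewrite -dimS; apply: cyclic_ext_of_subfield.
have imK : j @` [set` K] = range phi.
  apply/seteqP; split=> [_ [_ /memv_imgP[x _ ->] <-] | _ [x _ <-]].
    by exists x; rewrite ?Df.
  by exists (f x); [exact: fK | rewrite Df].
apply/seteqP; split; apply: generated_field_min;
    try exact: generated_field_subfield.
  have phiP : range phi `<=` compositum (j @` [set` S]) (range phi).
    by move=> x Mx; apply: sub_generated_field; right.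
  move=> x [/phiP // | ->]; rewrite -Dt.
  apply: (image_prodv_sub (j := j) (K := S) (L := K)
    (generated_field_subfield (j @` [set` S] `|` range phi))).
  - by move=> y Sy; apply: sub_generated_field; left.
  - by rewrite imK.
  - by exists t0.
move=> x [[y /= Sy <-] | Mx]; last by apply: sub_generated_field; left.
apply: (image_adjoin_sub (j := j) (K := K) (x := t0) (generated_field_subfield _)).
- by rewrite imK => u Mu; apply: sub_generated_field; left.
- by apply: sub_generated_field; right; rewrite /= Dt.
- by exists y => //=; apply: (subvP sST).
Qed.

(** * The cycle of implications between the three conditions *)

Theorem proposition1p7 (p n : nat) (F : fieldType)
    (Fbar : closedFieldType) (iota : {rmorphism F -> Fbar})
    (M : splittingFieldType F) (phi : {rmorphism M -> Fbar})
    (alpha : gal_of {:M} -> {unit 'Z_(p ^ n)})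
    (m : M) (t : Fbar)
    (p_prime : prime p) (p_odd : odd p) (n_ge1 : (1 <= n)%N)
    (Fbar_closure : algebraic_closure iota)
    (charF : p \notin [pchar F])
    (mupF : ~ (@mu Fbar p `<=` range iota))
    (phi_over : over_base iota phi)
    (M_def : range phi = adjoin (range iota) (@mu Fbar (p ^ n)))
    (degM : ~~ (p %| \dim {:M})%N)
    (alpha_def : cyclotomic_character alpha)
    (m_neq0 : m != 0) (m_npow : ~ exists z : M, m = z ^+ p)
    (t_root : t ^+ (p ^ n) = phi m) :
  let T := adjoin (range phi) [set t] in
  let J := adjoin (max_p_ext iota p) (@mu Fbar p) in
  [<-> exists2 S : set Fbar, cyclic_ext iota (p ^ n) S &
         T = compositum S (range phi);
       T `<=` J;
       forall g, g \in 'Gal({:M} / 1%VS)%g ->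
         power_class (p ^ n) (g m)
         = power_class (p ^ n) (m ^+ (FinRing.uval (alpha g)))].
Proof.
move=> T J; tfae.
- case=> S [L [jL [jLF DS galL cycL dimL]]] ->.
  have JP : is_subfield J by apply: generated_field_subfield.
  have sSJ : S `<=` J.
    move=> x Sx; apply: sub_generated_field; left; apply: sub_generated_field.
    by exists S => //; exists n, L, jL; split.
  apply: generated_field_min => // x [/sSJ // | [y _ <-]].
  (* M is generated over [F] by a p-th root of unity, which lies in [J], and [F] itself is contained
     in [S]. *)
  have [z /unity_rootP zp gen_z] :=
    cyclotomic_generator_p p_prime n_ge1 charF phi_over M_def degM.
  apply: (image_adjoin_sub (j := phi) (K := 1%AS) (x := z) JP).
  + move=> _ [_ /vlineP[a ->] <-]; rewrite phi_over; apply: sSJ.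
    by rewrite -DS; exists a%:A => //; apply: jLF.
  + apply: sub_generated_field; right; apply/unity_rootP.
    by rewrite -rmorphXn zp rmorph1.
  + by exists y => //=; rewrite gen_z memvf.
- move=> sTJ g gG; have Jt : J t.
    by apply: sTJ; apply: sub_generated_field; right.
  have [u nz_u ->] := twisted_class_of_sub p_prime n_ge1 Fbar_closure charF
    phi_over M_def degM m_neq0 t_root Jt gG (alpha_def _ gG).
  (* The factor u^(p^n) moves between the two cosets by replacing z with u z or u^-1 z. *)
  apply/seteqP; split=> [_ [z /= nz_z <-] | _ [z /= nz_z <-]].
    by exists (u * z); rewrite /= ?mulf_neq0 // exprMn mulrA.
  exists (u^-1 * z); rewrite /= ?mulf_neq0 ?invr_eq0 // -mulrA -exprMn.
  by rewrite mulVKf.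
- move=> twist; apply: (cyclic_descent p_prime n_ge1 Fbar_closure charF
    phi_over M_def degM m_neq0 m_npow t_root) => g gG.
  (* Membership of [g m] in its own coset, with z = 1, turns the equality of cosets into an explicit
     [u]. *)
  have: power_class (p ^ n) (g m) (g m).
    by exists 1; rewrite /= ?oner_neq0 // expr1n mulr1.
  rewrite twist // => -[u _ Du]; exists (FinRing.uval (alpha g)), u.
  by split=> [|//]; apply: alpha_def.
Qed.
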